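(* Any weakly bridged graph $G$ has $G^2$-connected medians; that is, for every profile $\pi$ on $G$, the median set $\mathrm{Med}(\pi)$ induces a connected subgraph of $G^2$.
   Context: Graphs are undirected, connected, without loops or multiple edges, and not necessarily finite. $d$ is the standard graph distance of $G=(V,E)$. $G^2$ has vertex set $V$, and distinct $u,v$ are adjacent iff $d(u,v)\le 2$. A profile is a map $\pi:V\to[0,\infty)$ with finite support, $F_\pi(x)=\sum_{u}\pi(u)d(u,x)$, and $\mathrm{Med}(\pi)$ is the set of vertices minimizing $F_\pi$. $G$ is weakly modular if for every vertex $u$ the following two conditions hold. Triangle condition: for any $v,w$ with $1=d(v,w)<d(u,v)=d(u,w)$ there is a common neighbor $x$ of $v,w$ with $d(u,x)=d(u,v)-1$. Quadrangle condition: for any $v,w,z$ with $d(v,z)=d(w,z)=1$ and $2=d(v,w)\le d(u,v)=d(u,w)=d(u,z)-1$ there is a common neighbor $x$ of $v,w$ with $d(u,x)=d(u,v)-1$. A vertex set is convex if it contains $I(x,y)=\{w:d(x,w)+d(w,y)=d(x,y)\}$ for any two of its vertices $x,y$. $G$ is weakly bridged if it is weakly modular and every ball $B_r(v)=\{x: d(v,x)\le r\}$ is convex. *)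

(* Defs.v *)
From mathcomp Require Import all_boot all_order all_algebra.
From mathcomp Require Import all_classical all_reals.

Set Implicit Arguments.
Unset Strict Implicit.
Unset Printing Implicit Defensive.

Import Order.TTheory GRing.Theory Num.Theory.

Local Open Scope classical_set_scope.

(* A graph on the (possibly infinite) vertex type V is given by its adjacency
   relation e : rel V. *)

Definition simple_graph (V : choiceType) (e : rel V) : Prop :=
  symmetric e /\ irreflexive e.

(* The subgraph of e induced by S is connected; the empty set counts as
   connected. *)
Definition connected_set (V : choiceType) (e : rel V) (S : set V) : Prop :=
  forall x y, S x -> S y ->
    exists p : seq V, [/\ path e x p, last x p = y & forall z, z \in p -> S z].

Definition connected_graph (V : choiceType) (e : rel V) : Prop :=
  connected_set e [set: V].

Definition joined_by (V : choiceType) (e : rel V) (x y : V) (n : nat) : Prop :=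
  exists p : seq V, [/\ path e x p, last x p = y & size p = n].

(* The value 0 between distinct components is junk: dist is only used on
   connected graphs. *)
Definition dist (V : choiceType) (e : rel V) (x y : V) : nat :=
  match pselect (exists n, `[< joined_by e x y n >]) with
  | left ex => ex_minn ex
  | right _ => 0
  end.

Definition graph_power (V : choiceType) (k : nat) (e : rel V) : rel V :=
  fun x y => (x != y) && (dist e x y <= k).

Definition triangle_condition (V : choiceType) (e : rel V) (u : V) : Prop :=
  forall v w, dist e v w = 1 -> 1 < dist e u v -> dist e u v = dist e u w ->
    exists x, [/\ e v x, e w x & dist e u x = dist e u v - 1].

Definition quadrangle_condition (V : choiceType) (e : rel V) (u : V) : Prop :=
  forall v w z, dist e v z = 1 -> dist e w z = 1 ->
    dist e v w = 2 -> 2 <= dist e u v ->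
    dist e u v = dist e u w -> dist e u w = dist e u z - 1 ->
    exists x, [/\ e v x, e w x & dist e u x = dist e u v - 1].

Definition weakly_modular (V : choiceType) (e : rel V) : Prop :=
  forall u, triangle_condition e u /\ quadrangle_condition e u.

Definition geodesic_interval (V : choiceType) (e : rel V) (x y : V) : set V :=
  [set w | dist e x w + dist e w y = dist e x y].

Definition graph_ball (V : choiceType) (e : rel V) (v : V) (r : nat) : set V :=
  [set x | dist e v x <= r].

Definition geodesically_convex (V : choiceType) (e : rel V) (S : set V) : Prop :=
  forall x y, S x -> S y -> geodesic_interval e x y `<=` S.

Definition weakly_bridged (V : choiceType) (e : rel V) : Prop :=
  weakly_modular e /\
  forall v r, geodesically_convex e (graph_ball e v r).

Local Open Scope ring_scope.

Definition profile (R : realType) (V : choiceType) (pi : V -> R) : Prop :=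
  (forall u, 0 <= pi u) /\ finite_set [set u | pi u != 0].

(* For a profile pi the summand has finite support, so this finitely supported
   big operator is the actual sum. *)
Definition median_fun (R : realType) (V : choiceType) (e : rel V) (pi : V -> R)
    (x : V) : R :=
  \sum_(u \in [set: V]) pi u * (dist e u x)%:R.

Definition Med (R : realType) (V : choiceType) (e : rel V) (pi : V -> R) :
    set V :=
  [set x | forall y, median_fun e pi x <= median_fun e pi y].

Definition power_connected_medians (R : realType) (V : choiceType) (k : nat)
    (e : rel V) : Prop :=
  forall pi : V -> R, profile pi ->
    connected_set (graph_power k e) (Med e pi).

(* Main.v *)
Require Import Defs.
From mathcomp Require Import all_boot all_order all_algebra.
From mathcomp Require Import all_classical all_reals.
From mathcomp Require Import zify lra.

Set Implicit Arguments.
Unset Strict Implicit.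
Unset Printing Implicit Defensive.

Import Order.TTheory GRing.Theory Num.Theory.

(** The heart of the proof is a convexity property of the median function F
    at distance three: if d(u,v) = 3, there is a geodesic u, s, t, v with
    F(s) + F(t) <= F(u) + F(v).  As F is a nonnegative combination of finitely
    many functions d(x,.), it suffices that one geodesic satisfies
    d(x,s) + d(x,t) <= d(x,u) + d(x,v) for all x in a given finite set
    (distance_three_shrink).

    Let S and T be the sets of neighbours of u and of v on geodesics from u
    to v.  By convexity of balls both are cliques, and the edges between them
    are nested: the neighbourhoods in T of the vertices of S form a chain
    (first_steps_nested).  Hence any finite subset of T lies in the
    neighbourhood of a single s in S, and conversely.  So s can be chosen
    adjacent to a vertex of T nearest to x, for every x of the finite set,
    and t adjacent to s and to a vertex of S nearest to x, for every x.  For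
    such s and t, say with d(x,u) <= d(x,v), convexity of balls leaves only two
    ways for the inequality to fail: the distances from x along u, s, t, v are
    a, a+1, a+1, a+1 or a, a+1, a+2, a+2.  In both, the triangle condition gives
    a vertex of T, respectively of S, at distance a from x; the nearest vertex
    of that clique, which is adjacent to s, respectively to t, then contradicts
    the convexity of a ball, respectively the triangle inequality.

    To pass to arbitrary medians u and v, take among all geodesics
    p_0, ..., p_k from u to v one minimising the sum of the F(p_i).  Rerouting
    it between p_i and p_(i+3), through the two vertices that the convexity at
    distance three provides, cannot decrease the sum, so
    F(p_(i+1)) + F(p_(i+2)) <= F(p_i) + F(p_(i+3)) for all i: the increments
    F(p_(i+1)) - F(p_i) with i of a fixed parity are nondecreasing.  Since
    F(p_0) = F(p_k) is the minimum of F, this forces p_1 or p_2 to be a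
    median (interior_minimum).  So if k > 2, some median at distance at most
    two from u is closer to v, and induction on k concludes. *)

Local Open Scope nat_scope.

(** * The graph distance *)

Section WeaklyBridged.
Context (V : choiceType) (e : rel V).
Context (e_simple : simple_graph e) (e_connected : connected_graph e).

Lemma adj_sym x y : e x y -> e y x.
Proof. by case: e_simple => s _; rewrite s. Qed.

(** Connectedness rules out the default value of the distance. *)
Lemma joined_by_dist x y : joined_by e x y (dist e x y).
Proof.
rewrite /dist; case: pselect => [ex|[]].
  by case: ex_minnP => n /asboolP.
have [p [ep lp _]] := @e_connected x y I I.
by exists (size p); apply/asboolP; exists p.
Qed.

Lemma dist_min x y n : joined_by e x y n -> dist e x y <= n.
Proof.
move=> xyn; rewrite /dist; case: pselect => [ex|//].
by case: ex_minnP => m _; apply; apply/asboolP.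
Qed.

Lemma distxx x : dist e x x = 0.
Proof. by apply/eqP; rewrite -leqn0; apply: dist_min; exists [::]. Qed.

Lemma dist0_eq x y : dist e x y = 0 -> x = y.
Proof. by have [p [_ <- <-]] := joined_by_dist x y => /size0nil ->. Qed.

Lemma dist_triangle y x z : dist e x z <= dist e x y + dist e y z.
Proof.
have [p [ep lp <-]] := joined_by_dist x y.
have [q [eq lq <-]] := joined_by_dist y z.
apply: dist_min; exists (p ++ q).
by rewrite cat_path last_cat lp ep eq size_cat.
Qed.

Lemma dist_sym x y : dist e x y = dist e y x.
Proof.
suff le a b : dist e a b <= dist e b a by apply/eqP; rewrite eqn_leq !le.
have [p [ep lp <-]] := joined_by_dist b a.
apply: dist_min; exists (rev (belast b p)); split.
- rewrite -lp rev_path; apply: sub_path ep => c d; exact: adj_sym.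
- case: p {ep} lp => [/= -> //|c p _].
  by rewrite /= rev_cons last_rcons.
- by rewrite size_rev size_belast.
Qed.

Lemma dist_adj x y : e x y -> dist e x y = 1.
Proof.
move=> exy; have le1 : dist e x y <= 1.
  by apply: dist_min; exists [:: y]; rewrite /= exy.
have : dist e x y <> 0.
  by move=> /dist0_eq xy; case: e_simple => _ irr; rewrite xy irr in exy.
lia.
Qed.

Lemma adj_dist x y : dist e x y = 1 -> e x y.
Proof.
have [p [ep lp <-]] := joined_by_dist x y.
by case: p ep lp => [|z [|? ?]] //= /andP[exz _] <-.
Qed.

Lemma dist_step u x y : e x y -> dist e u y <= (dist e u x).+1.
Proof. by move=> /dist_adj exy; have := dist_triangle x u y; lia. Qed.

Lemma dist2_adj x y z : e x z -> e z y -> x = y \/ e x y \/ dist e x y = 2.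
Proof.
move=> /dist_adj xz /dist_adj zy; have := dist_triangle z x y.
rewrite xz zy; case E: (dist e x y) => [|[|[|]]] // _.
- by left; apply: dist0_eq.
- by right; left; apply: adj_dist.
- by right; right.
Qed.

Lemma dist2_mid x y : dist e x y = 2 -> exists2 z, e x z & e z y.
Proof.
have [p [ep lp <-]] := joined_by_dist x y.
by case: p ep lp => [|z [|t [|? ?]]] //= /and3P[? ? _] <- _; exists z.
Qed.

(** A function on all of nat, instead of a sequence, so that vertices are
    accessed and replaced by index; values beyond the distance are arbitrary. *)
Definition geodesic_walk (u v : V) (p : nat -> V) : Prop :=
  [/\ p 0 = u, p (dist e u v) = v
    & forall i, i < dist e u v -> e (p i) (p i.+1)].

Lemma geodesic_walk_exists u v : exists p, geodesic_walk u v p.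
Proof.
have [q [eq lq sq]] := joined_by_dist u v.
exists (nth u (u :: q)); split => //.
- by rewrite -sq -lq -(last_nth u).
- by move=> i; rewrite -sq => iq; move/(pathP u): eq => /(_ i iq).
Qed.

Lemma dist_walk_le k (p : nat -> V) i j :
  (forall i, i < k -> e (p i) (p i.+1)) -> i <= j <= k ->
  dist e (p i) (p j) <= j - i.
Proof.
move=> ep; elim: j => [|j IH] /andP[ij jk].
  have -> : i = 0 by lia.
  by rewrite distxx.
have [->|lt] := eqVneq i j.+1; first by rewrite distxx.
have := dist_step (p i) (ep j jk).
have := IH ltac:(lia); lia.
Qed.

(** If some stretch of the walk were not geodesic, the whole walk could be
    shortened. *)
Lemma dist_geodesic_walk u v p i j :
  geodesic_walk u v p -> i <= j <= dist e u v ->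
  dist e (p i) (p j) = j - i.
Proof.
move=> [p0 pk ep] ij.
have h1 := @dist_walk_le _ p 0 i ep ltac:(lia).
have h2 := @dist_walk_le _ p i j ep ltac:(lia).
have h3 := @dist_walk_le _ p j (dist e u v) ep ltac:(lia).
have h4 := dist_triangle (p i) u v.
have h5 := dist_triangle (p j) (p i) v.
rewrite p0 in h1; rewrite pk in h3; lia.
Qed.


Lemma geodesic_walk_reroute u v p i s t :
  geodesic_walk u v p -> i.+3 <= dist e u v ->
  e (p i) s -> e s t -> e t (p i.+3) ->
  geodesic_walk u v
    (fun j => if j == i.+1 then s else if j == i.+2 then t else p j).
Proof.
move=> [p0 pk ep] lt_i ps st tp; split.
- by [].
- by rewrite !gtn_eqF // ltnW.
- move=> j jk; rewrite !eqSS.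
  have [->|ji] := eqVneq j i; first by rewrite !ltn_eqF.
  have [_|_] := eqVneq j i.+1; first by [].
  have [->|_] := eqVneq j i.+2; first by [].
  exact: ep.
Qed.

(** * Pairs at distance three *)

Context (e_triangle : forall u, triangle_condition e u).
Context (e_ball : forall v r, geodesically_convex e (graph_ball e v r)).

Local Notation d := (dist e).

(** This is the form in which convexity of balls is mostly used: if a and b were
    at distance two, c would lie on a geodesic between two vertices of the ball
    of radius r around x, hence in that ball. *)
Lemma no_strict_peak x r a b c :
  e a c -> e c b -> d x a <= r -> d x b <= r -> r < d x c -> a = b \/ e a b.
Proof.
move=> ac cb xa xb xc.
have [?|[?|ab]] := dist2_adj ac cb; [by left|by right|exfalso].
have : graph_ball e x r c.
  apply: (e_ball xa xb); rewrite /geodesic_interval /=.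
  by rewrite (dist_adj ac) (dist_adj cb).
by rewrite /graph_ball /=; lia.
Qed.

Lemma dist_interval_le x a b w :
  d a w + d w b = d a b -> d x w <= maxn (d x a) (d x b).
Proof.
by move=> abw; apply: (@e_ball x (maxn (d x a) (d x b)) a b) => //;
  rewrite /graph_ball /= ?leq_maxl ?leq_maxr.
Qed.

Definition first_step (u v s : V) : Prop := e u s /\ d s v = 2.

(** Otherwise u would be a strict peak of d(v,.) between s and s'. *)
Lemma first_step_clique u v s s' :
  d u v = 3 -> first_step u v s -> first_step u v s' -> s = s' \/ e s s'.
Proof.
move=> uv [us sv] [us' s'v].
apply: (@no_strict_peak v 2 _ _ u); rewrite ?(dist_sym v) //.
- exact: adj_sym.
- by rewrite sv.
- by rewrite s'v.
- by rewrite uv.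
Qed.

(** If both conclusions failed, s, s', t', t would be an induced 4-cycle, and
    the unit ball around s would contain t and s' without their common
    neighbour t'. *)
Lemma first_steps_nested u v s s' t t' :
  d u v = 3 -> first_step u v s -> first_step u v s' ->
  first_step v u t -> first_step v u t' ->
  e s t -> e s' t' -> e s t' \/ e s' t.
Proof.
move=> uv Ss Ss' Tt Tt' st s't'.
have vu : d v u = 3 by rewrite dist_sym.
have [<-|ss'] := first_step_clique uv Ss Ss'; first by right.
have [eqt|tt'] := first_step_clique vu Tt Tt'; first by left; rewrite -eqt.
have [st'|st'] := leqP (d s t') 1.
  left; apply: adj_dist.
  have : d s t' <> 0.
    move=> /dist0_eq eq; have [_] := Ss; have [vt' _] := Tt'.
    by rewrite eq dist_sym (dist_adj vt').
  lia.
right; have [||eqt|/adj_sym//] := no_strict_peak tt' (adj_sym s't') _ _ st'.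
- by rewrite (dist_adj st).
- by rewrite (dist_adj ss').
- by have [_] := Ss'; have [vt _] := Tt; rewrite -eqt dist_sym (dist_adj vt).
Qed.

Lemma first_step_opposite u v t :
  d u v = 3 -> first_step v u t -> exists2 s, first_step u v s & e s t.
Proof.
move=> uv [vt tu].
have [s ts su] := dist2_mid tu.
exists s; last exact: adj_sym.
split; first exact: adj_sym.
have := dist_triangle s u v; have := dist_triangle t s v.
rewrite (dist_adj (adj_sym ts)) (dist_adj (adj_sym vt)).
rewrite (dist_adj (adj_sym su)) uv; lia.
Qed.

Lemma first_step_exists u v : d u v = 3 -> exists s, first_step u v s.
Proof.
move=> uv; have [p gp] := geodesic_walk_exists u v.
have := @dist_geodesic_walk u v p 1 3 gp; case: gp; rewrite uv => p0 p3 ep.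
rewrite p3 => /(_ isT) p1v; exists (p 1); split=> //.
by rewrite -{1}p0; apply: ep.
Qed.

(** Finitely many vertices on the side of v have a common neighbour on the side
    of u, because the neighbourhoods form a chain.  The list is finite since in
    an infinite graph a chain need not have a largest member. *)
Lemma first_step_dominating u v (L : seq V) :
  d u v = 3 -> (forall t, t \in L -> first_step v u t) ->
  exists2 s, first_step u v s & forall t, t \in L -> e s t.
Proof.
move=> uv; elim: L => [|t0 L IH] TL.
  by have [s Ss] := first_step_exists uv; exists s.
have [t tL|s Ss sL] := IH; first by apply: TL; rewrite inE tL orbT.
have Tt0 : first_step v u t0 by apply: TL; rewrite inE eqxx.
have [s0 Ss0 s0t0] := first_step_opposite uv Tt0.
have [st0|nst0] := boolP (e s t0).
  by exists s => // t; rewrite inE => /orP[/eqP->|/sL].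
(* Nestedness: s misses t0, so every t adjacent to s is adjacent to s0. *)
exists s0 => // t; rewrite inE => /orP[/eqP->//|tL].
have Tt : first_step v u t by apply: TL; rewrite inE tL orbT.
have [|//] := first_steps_nested uv Ss Ss0 Tt Tt0 (sL t tL) s0t0.
by rewrite (negbTE nst0).
Qed.

Definition nearest_first_step (u v x s : V) : Prop :=
  first_step u v s /\ forall s', first_step u v s' -> d x s <= d x s'.

Lemma nearest_first_step_exists u v x :
  d u v = 3 -> exists s, nearest_first_step u v x s.
Proof.
move=> uv.
pose P n := `[< exists2 s, first_step u v s & d x s = n >].
have exP : exists n, P n.
  by have [s Ss] := first_step_exists uv; exists (d x s); apply/asboolP; exists s.
case: (ex_minnP exP) => n /asboolP[s Ss <-] smin; exists s; split=> // s' Ss'.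
by apply: smin; apply/asboolP; exists s'.
Qed.

Lemma dist_le2 x y z : e x y -> e y z -> d x z <= 2.
Proof. by move=> xy /(dist_step x); rewrite (dist_adj xy). Qed.

Lemma first_step_near u v s :
  d u v = 3 -> e u s -> d s v <= 2 -> first_step u v s.
Proof.
move=> uv us sv; split=> //; apply/eqP; rewrite eqn_leq sv /=.
by have := dist_triangle s u v; rewrite uv (dist_adj us) add1n ltnS.
Qed.

(** The triangle condition lowers the edges s t and t v to vertices z and y at
    distance a from x.  Having no strict peak above a forces u, z, y to be
    consecutive or equal, so y is within distance two of u. *)
Lemma first_step_bypass_plateau3 u v x s t a :
  d u v = 3 -> e u s -> e s t -> e t v -> 0 < a ->
  d x u = a -> d x s = a.+1 -> d x t = a.+1 -> d x v = a.+1 ->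
  exists2 t', first_step v u t' & d x t' = a.
Proof.
move=> uv us st tv a0 xu xs xt xv.
have [z [sz tz]] : exists z, [/\ e s z, e t z & d x z = d x s - 1].
  by apply: e_triangle; rewrite ?(dist_adj st) ?xs ?xt.
have [y [ty vy]] : exists y, [/\ e t y, e v y & d x y = d x t - 1].
  by apply: e_triangle; rewrite ?(dist_adj tv) ?xt ?xv.
rewrite xs xt subn1 /= => xy xz; exists y => //.
apply: first_step_near; rewrite // dist_sym //.
have [uz|uz] : u = z \/ e u z.
  by apply: (no_strict_peak us sz (x := x) (r := a)); rewrite ?xu ?xz ?xs.
  by apply: dist_le2 ty; rewrite uz; apply: adj_sym.
have [<-|zy] : z = y \/ e z y; last exact: dist_le2 uz zy.
  by apply: (no_strict_peak (adj_sym tz) ty (x := x) (r := a)); rewrite ?xy ?xz ?xt.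
by rewrite (dist_adj uz).
Qed.

(** The triangle condition lowers the edge t v to y at distance a + 1, which must
    be adjacent to s, and then the edge s y to z at distance a, which must be
    adjacent to u; so u, z, y, v is a geodesic. *)
Lemma first_step_bypass_plateau2 u v x s t a :
  d u v = 3 -> e u s -> e s t -> e t v -> 0 < a ->
  d x u = a -> d x s = a.+1 -> d x t = a.+2 -> d x v = a.+2 ->
  exists2 s', first_step u v s' & d x s' = a.
Proof.
move=> uv us st tv a0 xu xs xt xv.
have [y [ty vy]] : exists y, [/\ e t y, e v y & d x y = d x t - 1].
  by apply: e_triangle; rewrite ?(dist_adj tv) ?xt ?xv.
rewrite xt subn1 /= => xy.
have [sy|sy] : s = y \/ e s y.
  by apply: (no_strict_peak st ty (x := x) (r := a.+1)); rewrite ?xs ?xy ?xt.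
  by rewrite sy in us; have := dist_le2 us (adj_sym vy); rewrite uv.
have [z [sz yz]] : exists z, [/\ e s z, e y z & d x z = d x s - 1].
  by apply: e_triangle; rewrite ?(dist_adj sy) ?xs ?xy.
rewrite xs subn1 /= => xz; exists z => //.
have [uz|uz] : u = z \/ e u z.
  by apply: (no_strict_peak us sz (x := x) (r := a)); rewrite ?xu ?xz ?xs.
  by have := dist_le2 (adj_sym yz) (adj_sym vy); rewrite -uz uv.
by apply: first_step_near => //; apply: dist_le2 (adj_sym yz) (adj_sym vy).
Qed.

(** Convexity of balls bounds d(x,s) and d(x,t) by d(x,v), so the inequality
    can only fail if d(x,s) = d(x,u) + 1 and d(x,t) = d(x,v), where d(x,v) exceeds
    d(x,u) by one or two; first_step_bypass_plateau3 and
    first_step_bypass_plateau2 deal with these two cases. *)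
Lemma nearest_first_steps_dist u v x s t s' t' :
  d u v = 3 -> e u s -> e s t -> e t v ->
  nearest_first_step u v x s' -> nearest_first_step v u x t' ->
  e s t' -> e s' t ->
  d x u <= d x v -> d x s + d x t <= d x u + d x v.
Proof.
move=> uv us st tv [_ s'min] [[vt' t'u] t'min] st' s't ab.
have [_ sv] := first_step_near uv us (dist_le2 st tv).
have [_] : first_step v u t.
  apply: first_step_near; rewrite 1?dist_sym //; first exact: adj_sym.
  exact: dist_le2 us st.
rewrite dist_sym => ut.
have xt := dist_step x st; have xs := dist_step x us.
have := @dist_interval_le x u v s; rewrite (dist_adj us) sv uv => /(_ erefl).
rewrite (maxn_idPr ab) => xs_le.
have := @dist_interval_le x u v t; rewrite ut (dist_adj tv) uv => /(_ erefl).
rewrite (maxn_idPr ab) => xt_le.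
rewrite leqNgt; apply/negP => bad.
have Es : d x s = (d x u).+1 by clear - xs xt_le bad; lia.
have Et : d x t = d x v by clear - xt_le bad xs Es; lia.
have a0 : 0 < d x u.
  rewrite lt0n; apply/eqP => /[dup] xu0 /dist0_eq xu.
  by rewrite Et Es xu0 xu uv in xt.
have [b1|b2] : d x v = (d x u).+1 \/ d x v = (d x u).+2.
  by clear - Es Et xs_le xt; lia.
- have [y Ty xy] : exists2 y, first_step v u y & d x y = d x u.
    by apply: (first_step_bypass_plateau3 uv us st tv); rewrite ?Et.
  have [ut'|ut'] : u = t' \/ e u t'.
    apply: (no_strict_peak us st' (x := x) (r := d x u)); rewrite ?Es //.
    by rewrite -xy; apply: t'min.
  + by rewrite -ut' distxx in t'u.
  + by rewrite dist_sym (dist_adj ut') in t'u.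
- have [z Sz xz] : exists2 z, first_step u v z & d x z = d x u.
    by apply: (first_step_bypass_plateau2 uv us st tv); rewrite ?Et.
  by have := dist_step x s't; rewrite Et b2 ltnS ltnNge -xz (s'min z Sz).
Qed.

(** The pair s, t depends on the finite set X, but serves all its vertices at
    once; it can therefore be summed against any weights on X. *)
Lemma distance_three_shrink u v (X : seq V) :
  d u v = 3 ->
  exists s t, [/\ e u s, e s t, e t v
    & forall x, x \in X -> d x s + d x t <= d x u + d x v].
Proof.
move=> uv; have vu : d v u = 3 by rewrite dist_sym.
have [g gP] := choice (fun x => nearest_first_step_exists x uv).
have [h hP] := choice (fun x => nearest_first_step_exists x vu).
have [s Ss sL] : exists2 s, first_step u v s & forall t, t \in map h X -> e s t.
  by apply: first_step_dominating => // t /mapP[x _ ->]; case: (hP x).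
(* Adding s to the list makes t adjacent to s. *)
have [t Tt tL] : exists2 t, first_step v u t
    & forall s', s' \in s :: map g X -> e t s'.
  apply: first_step_dominating => // s'; rewrite inE => /orP[/eqP->//|].
  by move=> /mapP[x _ ->]; case: (gP x).
have st : e s t by apply: adj_sym; apply: tL; rewrite inE eqxx.
have [[us _] [/adj_sym tv _]] := (Ss, Tt).
exists s, t; split=> // x xX.
have st' : e s (h x) by apply: sL; apply: map_f.
have s't : e (g x) t by apply: adj_sym; apply: tL; rewrite inE map_f ?orbT.
have [xuv|/ltnW xvu] := leqP (d x u) (d x v).
  exact: nearest_first_steps_dist (gP x) (hP x) _ _ xuv.
(* The roles of (u, s) and (v, t) are symmetric. *)
rewrite addnC [leqRHS]addnC.
by apply: nearest_first_steps_dist (hP x) (gP x) _ _ xvu => //; apply: adj_sym.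
Qed.

End WeaklyBridged.

Local Open Scope ring_scope.

(** * Minimising geodesics *)

(** The weighted sums are real, but they only depend on the values n a x,
    bounded naturals indexed by a finite list, hence take finitely many
    values.  This replaces finiteness of the set of geodesics, which may fail in
    a graph with vertices of infinite degree. *)
Lemma exists_min_weighted (R : realType) (V : eqType) (T : Type)
    (P : T -> Prop) (w : V -> R) (X : seq V) (n : T -> V -> nat) (N : nat) :
  (forall a x, P a -> x \in X -> (n a x <= N)%N) -> (exists a, P a) ->
  exists2 a, P a & forall b, P b ->
    \sum_(x <- X) w x * (n a x)%:R <= \sum_(x <- X) w x * (n b x)%:R.
Proof.
move=> nN [a0 Pa0].
pose g a : {ffun 'I_(size X) -> 'I_N.+1} :=
  [ffun i => inord (n a (tnth (in_tuple X) i))].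
pose h (f : {ffun 'I_(size X) -> 'I_N.+1}) : R :=
  \sum_i w (tnth (in_tuple X) i) * (f i)%:R.
have hg a : P a -> h (g a) = \sum_(x <- X) w x * (n a x)%:R.
  move=> Pa; rewrite big_tnth; apply: eq_bigr => i _.
  by rewrite ffunE inordK // ltnS nN // mem_tnth.
pose Q f := `[< exists2 a, P a & g a = f >].
have Q0 : Q (g a0) by apply/asboolP; exists a0.
case: (@arg_minP _ _ _ (g a0) Q h Q0) => f /asboolP[a Pa <-] fmin.
exists a => // b Pb; rewrite -!hg //; apply: fmin.
by apply/asboolP; exists b.
Qed.

Lemma sum_replace_two (R : realType) (A B : nat -> R) (n i : nat) :
  (i.+1 < n)%N -> (forall j, j != i -> j != i.+1 -> A j = B j) ->
  \sum_(j < n) A j <= \sum_(j < n) B j -> A i + A i.+1 <= B i + B i.+1.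
Proof.
move=> lt_i AB.
pose o := Ordinal (ltnW lt_i); pose o' := Ordinal lt_i.
have o'o : o' != o by rewrite -val_eqE /= neq_ltn ltnSn orbT.
rewrite (bigD1 o) // (bigD1 o') //= [leRHS](bigD1 o) // (bigD1 o') //=.
rewrite (eq_bigr (fun j : 'I_n => B j)); last by move=> j /andP[*]; apply: AB.
by rewrite !addrA lerD2r.
Qed.

(** The hypothesis says that G(i+1) - G(i) <= G(i+3) - G(i+2).  Suppose that G(1)
    and G(2) exceed m.  The increments from even indices are then at least
    G(1) - G(0) > 0, so k cannot be odd, as the last increment ends at the
    minimum.  Two consecutive increments, the first from an even index, add up
    to at least G(2) - G(0) > 0, so G exceeds m at all
    even indices from 2 on, and k cannot be even either. *)
Lemma interior_minimum (R : realType) (G : nat -> R) (k : nat) (m : R) :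
  (1 < k)%N -> G 0%N = m -> G k = m -> (forall i, m <= G i) ->
  (forall i, (i.+3 <= k)%N -> G i.+1 + G i.+2 <= G i + G i.+3) ->
  G 1%N <= m \/ G 2%N <= m.
Proof.
move=> k1 G0 Gk Gm Gcvx.
have [?|G1] := lerP (G 1%N) m; [by left|right].
have even_incr j : (j.*2 < k)%N -> G 1%N - G 0%N <= G j.*2.+1 - G j.*2.
  elim: j => [//|j IH] lt_j; rewrite doubleS in lt_j *.
  have := Gcvx j.*2 lt_j; have := IH ltac:(lia); lra.
have odd_incr j : (j.*2.+1 < k)%N -> G 2%N - G 1%N <= G j.*2.+2 - G j.*2.+1.
  elim: j => [//|j IH] lt_j; rewrite doubleS in lt_j *.
  have := Gcvx j.*2.+1 lt_j; have := IH ltac:(lia); lra.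
have [//|G2] := lerP (G 2%N) m.
have even_up j : (j.*2.+1 < k)%N -> m < G j.*2.+2.
  elim: j => [//|j IH] lt_j.
  have := odd_incr j.+1 lt_j; have := even_incr j.+1 (ltnW lt_j).
  rewrite doubleS in lt_j *; have := IH ltac:(lia); lra.
have [] := boolP (odd k) => odd_k; move: (odd_double_half k).
- rewrite odd_k add1n => Ek; have := even_incr k./2 ltac:(lia).
  by rewrite Ek Gk G0; have := Gm k./2.*2; lra.
- rewrite (negbTE odd_k) add0n => Ek; have := even_up k./2.-1 ltac:(lia).
  have -> : k./2.-1.*2.+2 = k by lia.
  by rewrite Gk ltxx.
Qed.

Section Medians.
Context (R : realType) (V : choiceType) (e : rel V) (pi : V -> R).
Context (e_simple : simple_graph e) (e_connected : connected_graph e).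
Context (e_wb : weakly_bridged e) (pi_profile : profile pi).

Local Notation d := (dist e).
Local Notation F := (median_fun e pi).

Lemma median_fun_seq :
  exists X : seq V, forall y, F y = \sum_(x <- X) pi x * (d x y)%:R.
Proof.
have [_ /finite_seqP[X suppX]] := pi_profile.
exists (undup X) => y; rewrite /median_fun (fsbigE (undup X)) ?undup_uniq //.
  by apply: eq_bigl => x; rewrite in_setT.
move=> x _; rewrite mem_undup => xX.
suff -> : pi x = 0 by rewrite mul0r.
apply/eqP/negPn/negP => pix; move/negP: xX; apply.
by have : [set u | pi u != 0]%classic x by []; rewrite suppX.
Qed.

(** A geodesic minimising the sum of F over its vertices has this property,
    because rerouting it by distance_three_shrink between p i and p i.+3 cannot decrease the sum. *)
Lemma exists_convex_geodesic u v :
  exists2 p, geodesic_walk e u v p &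
    forall i, (i.+3 <= d u v)%N -> F (p i.+1) + F (p i.+2) <= F (p i) + F (p i.+3).
Proof.
have [X FX] := median_fun_seq; have [pi_ge0 _] := pi_profile.
pose k := d u v.
pose n (p : nat -> V) x := (\sum_(i < k.+1) d x (p i))%N.
(* Every vertex of a geodesic is within k of u. *)
pose N := (k.+1 * (\max_(y <- X) d y u + k))%N.
have nN p x : geodesic_walk e u v p -> x \in X -> (n p x <= N)%N.
  move=> gp xX; rewrite /n /N -[X in (X * _)%N]card_ord -sum_nat_const.
  apply: leq_sum => i _; apply: leq_trans (dist_triangle e_connected u x _) _.
  apply: leq_add; first exact: leq_bigmax_seq.
  have ik : (0 <= i <= d u v)%N by rewrite /= -ltnS.
  have := dist_geodesic_walk e_simple e_connected gp ik.
  by case: gp => -> _ _ ->; rewrite subn0 -ltnS.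
have sumF p : \sum_(x <- X) pi x * (n p x)%:R = \sum_(i < k.+1) F (p i).
  under [RHS]eq_bigr do rewrite FX.
  rewrite exchange_big /=; apply: eq_bigr => x _.
  by rewrite natr_sum mulr_sumr.
have [p gp pmin] := exists_min_weighted pi nN (geodesic_walk_exists e_connected u v).
exists p => // i lt_i.
have pi3 : d (p i) (p i.+3) = 3%N.
  by rewrite (dist_geodesic_walk e_simple e_connected gp) ?leqW //; lia.
have [wm ball] := e_wb.
have [s [t [us st tv Xst]]] := distance_three_shrink e_simple e_connected
  (fun u => (wm u).1) ball X pi3.
apply: (@le_trans _ _ (F s + F t)); last first.
  rewrite !FX -!big_split /= big_seq [leRHS]big_seq; apply: ler_sum => x xX.
  by rewrite -!mulrDr -!natrD ler_wpM2l // ler_nat Xst.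
have gq := geodesic_walk_reroute gp lt_i us st tv.
have := pmin _ gq; rewrite !sumF => le_sum.
have := @sum_replace_two R (fun j => F (p j))
  (fun j => F (if j == i.+1 then s else if j == i.+2 then t else p j)) k.+1 i.+1.
rewrite /= eqxx gtn_eqF // eqxx; apply => //.
- by rewrite ltnS ltnW.
- by move=> j /negbTE-> /negbTE->.
Qed.

(** Connectivity of the medians in the square follows by iterating this step. *)
Lemma Med_step u v :
  Med e pi u -> Med e pi v -> (2 < d u v)%N ->
  exists w, [/\ Med e pi w, graph_power 2 e u w & (d w v < d u v)%N].
Proof.
move=> Mu Mv uv; have [p gp pcvx] := exists_convex_geodesic u v.
have [p0 pk _] := gp.
have Fuv : F v = F u by apply/le_anti; rewrite Mu Mv.
have near i : (0 < i <= 2)%N -> F (p i) <= F u ->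
    exists w, [/\ Med e pi w, graph_power 2 e u w & (d w v < d u v)%N].
  move=> i2 Fi; exists (p i).
  have upi : d u (p i) = i.
    rewrite -{1}p0 (dist_geodesic_walk e_simple e_connected gp) ?subn0 //; lia.
  split.
  - by move=> y; apply: le_trans Fi (Mu y).
  - rewrite /graph_power upi; apply/andP; split; last by lia.
    by apply/eqP => upi'; rewrite -upi' distxx in upi; rewrite -upi in i2.
  - by rewrite -{1}pk (dist_geodesic_walk e_simple e_connected gp) //; lia.
have [||||||] := @interior_minimum R (fun i => F (p i)) (d u v) (F u) => //.
- exact: ltnW.
- by rewrite p0.
- by rewrite pk.
- exact: near.
- exact: near.
Qed.

End Medians.

Theorem theorem45 (R : realType) (V : choiceType) (e : rel V)
    (e_simple : simple_graph e) (e_connected : connected_graph e)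
    (e_wb : weakly_bridged e) :
  power_connected_medians R 2 e.
Proof.
move=> pi pi_profile x y.
have [n] := ubnP (dist e x y); elim: n x => // n IH x lt_n Mx My.
have [xy|xy] := eqVneq x y; first by exists [::]; rewrite xy.
have [d2|d2] := leqP (dist e x y) 2.
  exists [:: y]; rewrite /= /graph_power xy d2; split=> // z.
  by rewrite inE => /eqP->.
have [w [Mw xw wy]] := Med_step e_simple e_connected e_wb pi_profile Mx My d2.
have [q [qpath qlast Mq]] := IH w (leq_trans wy lt_n) Mw My.
exists (w :: q); rewrite /= xw; split=> // z.
by rewrite inE => /orP[/eqP->|/Mq].
Qed.
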